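(* Let $G_1$ be an $r_1$-regular graph with $n_1$ vertices and $m_1$ edges and let $G_2$ be an arbitrary graph with $n_2$ vertices. Then the adjacency characteristic polynomial of the central edge corona $G_1\underline{\odot}G_2$ is (as an identity of rational functions in $x$) $$\begin{aligned}f(A(G_1\underline{\odot}G_2),x)=\;&(x-\chi_{A(G_2)}(x))^{m_1-n_1}\prod_{j=1}^{n_2}(x-\lambda_j(G_2))^{m_1}\prod_{i=1}^{n_1}\Big[(x+1)(x-\chi_{A(G_2)}(x))-r_1\\&-P(\lambda_i(G_1))(x-\chi_{A(G_2)}(x))+(x-\chi_{A(G_2)}(x)-1)\lambda_i(G_1)\Big].\end{aligned}$$
   Context: All graphs are finite, simple and connected. For a graph $G$ on $n$ vertices, $A(G)$ is its adjacency matrix with eigenvalues $\lambda_1(G)\ge\dots\ge\lambda_n(G)$ (with multiplicity). For an $n\times n$ matrix $M$, $f(M,x)=\det(xI_n-M)$, and $\chi_M(x)=\mathbf 1^T(xI_n-M)^{-1}\mathbf 1$ is the sum of all entries of $(xI_n-M)^{-1}$ (the $M$-coronal). $P$ denotes the polynomial associated with $G_1$: if $G_1$ is connected $r_1$-regular on $n_1$ vertices with distinct adjacency eigenvalues $r_1=\theta_1,\theta_2,\dots,\theta_t$, then $P(x)=n_1\prod_{k=2}^t\frac{x-\theta_k}{r_1-\theta_k}$; thus $P(A(G_1))$ is the all-ones matrix, $P(r_1)=n_1$ and $P(\theta_k)=0$ for $k\ge2$. The central graph $C(G)$ of $G$ is obtained from $G$ by subdividing each edge of $G$ exactly once and joining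 all pairs of distinct vertices of $G$ that are nonadjacent in $G$; $\tilde V(G)=V(C(G))\setminus V(G)$ is the set of subdivision vertices, corresponding to the edges of $G$. The central edge corona $G_1\underline{\odot}G_2$ is obtained by taking $C(G_1)$ and $|\tilde V(G_1)|$ copies of $G_2$, and joining the $i$-th vertex of $\tilde V(G_1)$ to every vertex in the $i$-th copy of $G_2$, for each $i$. *)

(* Defs.v *)
From HB Require Import structures.
From mathcomp Require Import all_boot all_order all_algebra.

Set Implicit Arguments.
Unset Strict Implicit.
Unset Printing Implicit Defensive.

Import Order.TTheory GRing.Theory Num.Theory.
Local Open Scope ring_scope.

Record sgraph := SGraph {
  vertex :> finType;
  adj : rel vertex;
  adj_sym : symmetric adj;
  adj_irr : irreflexive adj }.

(* The empty graph is not connected. *)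
Definition connected_graph (G : sgraph) : Prop :=
  (0 < #|G|)%N /\ forall u v : G, connect (@adj G) u v.

Definition regular_graph (G : sgraph) (r : nat) : Prop :=
  forall u : G, #|[set v | adj u v]| = r.

Definition edges (G : sgraph) : {set {set G}} :=
  [set e | [exists u, exists v, adj u v && (e == [set u; v])]].

Definition edge (G : sgraph) : finType := {e : {set G} | e \in edges G}.

Section CentralGraph.
Variable G : sgraph.

(* inr e is the vertex subdividing the edge e. *)
Definition central_adj (p q : G + edge G) : bool :=
  match p, q with
  | inl u, inl v => (u != v) && ~~ adj u v
  | inl u, inr e => u \in val e
  | inr e, inl u => u \in val e
  | inr _, inr _ => false
  end.

Lemma central_adj_sym : symmetric central_adj.
Proof. by case=> [u|e] [v|f] //=; rewrite eq_sym adj_sym. Qed.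

Lemma central_adj_irr : irreflexive central_adj.
Proof. by case=> [u|e] //=; rewrite eqxx. Qed.

Definition central : sgraph := SGraph central_adj_sym central_adj_irr.

End CentralGraph.

Section CentralEdgeCorona.
Variables G1 G2 : sgraph.

(* inr (e, u) is the vertex u of the copy of G2 attached to the edge e. *)
Definition corona_adj (p q : central G1 + (edge G1 * G2)) : bool :=
  match p, q with
  | inl a, inl b => adj a b
  | inl a, inr (e, _) => a == inr e
  | inr (e, _), inl a => a == inr e
  | inr (e, u), inr (f, v) => (e == f) && adj u v
  end.

Lemma corona_adj_sym : symmetric corona_adj.
Proof.
case=> [a|[e u]] [b|[f v]] //=; first exact: central_adj_sym.
by rewrite eq_sym adj_sym.
Qed.

Lemma corona_adj_irr : irreflexive corona_adj.
Proof.
case=> [a|[e u]] /=; first exact: central_adj_irr.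
by rewrite adj_irr andbF.
Qed.

Definition central_edge_corona : sgraph := SGraph corona_adj_sym corona_adj_irr.

End CentralEdgeCorona.

(* Rows and columns follow the enumeration of the vertex type. *)
Definition adj_mx (R : nzRingType) (G : sgraph) : 'M[R]_#|G| :=
  \matrix_(i, j) (adj (enum_val i) (enum_val j))%:R.

(* Eigenvalues with algebraic multiplicity, in decreasing order.  The order of C
   is total only on reals, so sorting is meaningful only for real spectra, such
   as that of a symmetric real matrix. *)
Definition spectrum (C : numClosedFieldType) n (M : 'M[C]_n) : seq C :=
  sort >=%R (sval (closed_field_poly_normal (char_poly M))).

(* Indexed from 0: the largest eigenvalue is eigenval G ord0 when #|G| is a
   successor. *)
Definition eigenval (C : numClosedFieldType) (G : sgraph) (i : 'I_#|G|) : C :=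
  (spectrum (adj_mx C G))`_i.

Definition coronal (C : fieldType) n (M : 'M[C]_n) : {fraction {poly C}} :=
  ((const_mx 1 : 'cV_n)^T
     *m invmx (map_mx (@tofrac {poly C}) (char_poly_mx M))
     *m (const_mx 1 : 'cV_n)) 0 0.

(* undup leaves the distinct eigenvalues, and the filter removes the first of
   them, which is the degree r of the connected r-regular graph G. *)
Definition assoc_poly (C : numClosedFieldType) (G : sgraph) (r : nat) :
    {poly C} :=
  #|G|%:R *: \prod_(theta <- undup (spectrum (adj_mx C G)) | theta != r%:R)
    ((r%:R - theta)^-1 *: ('X - theta%:P)).

(* Main.v *)
Require Import Defs.
From HB Require Import structures.
From mathcomp Require Import all_boot all_order all_algebra.
From mathcomp Require Import perm spectral ring.

Set Implicit Arguments.
Unset Strict Implicit.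
Unset Printing Implicit Defensive.

Import Order.TTheory GRing.Theory Num.Theory.
Local Open Scope ring_scope.

(** Let A1, A2 be the adjacency matrices of G1, G2, let m, n be the numbers of
    edges and vertices of G1, J the all-ones matrix, chi the coronal of A2 and
    y = x - chi.  Everything takes place over the field of rational functions.

    The copies of G2 contribute to x I - A(corona) a block I_m (x) (x I - A2).
    Its determinant is the m-th power of the characteristic polynomial of A2,
    and its Schur complement replaces x by y at every subdivision vertex, because
    such a vertex is joined to all of one copy and the entries of the resolvent
    (x I - A2)^-1 sum to chi ([char_poly_corona]).  A second Schur complement
    removes the subdivision vertices.  Their block is y I_m, and the incidence
    matrix R of a regular graph satisfies R R^T = A1 + r1 I, so what is left is
    y^(m - n) det (((x + 1) y - r1) I - y J + (y - 1) A1) ([det_central]).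
    The division by y is legitimate: y times the characteristic polynomial of A2
    is the characteristic polynomial of a bordered matrix, hence nonzero
    ([sub_coronal_neq0]).

    Finally J = P(A1).  The matrix A1 is real symmetric, hence diagonalizable, and
    P vanishes at every eigenvalue other than r1, so P(A1) (A1 - r1) = 0 and each
    row of P(A1) is an eigenvector for r1, or zero.  On a connected regular graph
    such a row is constant, because the quadratic form of the Laplacian is a sum
    of squares over the edges ([degree_eigenvector_const]).  The row sums of P(A1)
    are P(r1) = n, so P(A1) = J ([adj_mx_diag]).  The remaining determinant is
    then that of a polynomial in A1, and so a product over the eigenvalues
    ([det_adj_polynomial]). *)

(** * Matrices indexed by finite types *)

(** The matrix of a two-variable function on finite types; rows and columns
    follow the enumerations, so that the adjacency matrix of a graph is literally
    of this form. *)
Definition fmx (R : Type) (S T : finType) (F : S -> T -> R) :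
    'M[R]_(#|S|, #|T|) :=
  \matrix_(i, j) F (enum_val i) (enum_val j).

Lemma eq_fmx (R : Type) (S T : finType) (F F' : S -> T -> R) :
  (forall s t, F s t = F' s t) -> fmx F = fmx F'.
Proof. by move=> eqF; apply/matrixP=> i j; rewrite !mxE eqF. Qed.

Lemma sum_enum_val (V : nmodType) (T : finType) (F : T -> V) :
  \sum_(i < #|T|) F (enum_val i) = \sum_t F t.
Proof. by rewrite -big_enum_val. Qed.

Lemma mul_fmx (R : pzSemiRingType) (S T U : finType)
    (F : S -> T -> R) (F' : T -> U -> R) :
  fmx F *m fmx F' = fmx (fun s u => \sum_t F s t * F' t u).
Proof.
apply/matrixP=> i j; rewrite !mxE.
under eq_bigr => k _ do rewrite !mxE.
by rewrite (sum_enum_val (fun t => F _ t * F' t _)).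
Qed.

Lemma fmx1 (R : pzSemiRingType) (T : finType) :
  fmx (fun s t : T => (s == t)%:R : R) = 1%:M.
Proof. by apply/matrixP=> i j; rewrite !mxE (inj_eq enum_val_inj). Qed.

Section Determinants.
Variable R : comNzRingType.

Lemma det_reindex n (T : finType) (h : 'I_n -> T) (F : T -> T -> R) :
  bijective h -> \det (\matrix_(i, j) F (h i) (h j)) = \det (fmx F).
Proof.
move=> bij_h; have en : n = #|T| by rewrite -(bij_eq_card bij_h) card_ord.
move: h bij_h; rewrite en => h bij_h.
have inj_s : injective (enum_rank \o h).
  exact: inj_comp enum_rank_inj (bij_inj bij_h).
pose s := perm inj_s.
have -> : \matrix_(i, j) F (h i) (h j) = row_perm s (col_perm s (fmx F)).
  by apply/matrixP=> i j; rewrite !mxE !permE /= !enum_rankK.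
rewrite row_permE col_permE !det_mulmx !det_perm odd_permV mulrCA mulrA.
by rewrite -mulrA -signr_addb addbb mulr1.
Qed.

Lemma det_fmx_bij (S T : finType) (h : S -> T) (F : T -> T -> R) :
  bijective h -> \det (fmx (fun s t => F (h s) (h t))) = \det (fmx F).
Proof.
by move=> bij_h; rewrite -(det_reindex F (bij_comp bij_h (@enum_val_bij S))).
Qed.

Lemma det_fmx_sum (S T : finType) (F : S + T -> S + T -> R) :
  \det (fmx F) =
  \det (block_mx (fmx (fun a b => F (inl a) (inl b)))
                 (fmx (fun a t => F (inl a) (inr t)))
                 (fmx (fun t a => F (inr t) (inl a)))
                 (fmx (fun t t' => F (inr t) (inr t')))).
Proof.
pose h (i : 'I_(#|S| + #|T|)) : S + T :=
  match split i with inl a => inl (enum_val a) | inr b => inr (enum_val b) end.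
pose g (p : S + T) : 'I_(#|S| + #|T|) :=
  match p with
  | inl a => lshift _ (enum_rank a)
  | inr b => rshift _ (enum_rank b)
  end.
have hl a : h (lshift _ a) = inl (enum_val a).
  by rewrite /h (unsplitK (inl _ a)).
have hr a : h (rshift _ a) = inr (enum_val a).
  by rewrite /h (unsplitK (inr _ a)).
have bij_h : bijective h.
  exists g => [i|[a|b]] /=; rewrite ?hl ?hr ?enum_rankK //.
  by case: (split_ordP i) => a ->; rewrite ?hl ?hr /g enum_valK.
rewrite -(det_reindex F bij_h); congr (\det _); apply/matrixP=> i j.
rewrite [LHS]mxE; case: (split_ordP i) => a ->; case: (split_ordP j) => b ->;
  by rewrite ?hl ?hr ?(block_mxEul, block_mxEur, block_mxEdl, block_mxEdr) mxE.
Qed.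

(** The determinant of the Kronecker product of an identity matrix with F is a
    power of det F: peel off one diagonal block at a time. *)
Lemma det_fmx_block_ord m (T : finType) (F : T -> T -> R) :
  \det (fmx (fun p q : 'I_m * T => (p.1 == q.1)%:R * F p.2 q.2)) =
  \det (fmx F) ^+ m.
Proof.
elim: m => [|m IHm].
  suff E0 : #|{: 'I_0 * T}| = 0%N.
    by move: (fmx _); rewrite E0 => M; rewrite det_mx00.
  by rewrite card_prod card_ord.
pose k (p : T + 'I_m * T) : 'I_m.+1 * T :=
  match p with inl t => (ord0, t) | inr q => (lift ord0 q.1, q.2) end.
have bij_k : bijective k.
  exists (fun p =>
      if unlift ord0 p.1 is Some i then inr (i, p.2) else inl p.2).
    by case=> [t|[i t]] /=; rewrite ?unlift_none ?liftK.
  by case=> i t /=; case: unliftP => [j|] ->.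
rewrite -(det_fmx_bij _ bij_k) det_fmx_sum /= exprS.
set B := (X in block_mx _ X _ _).
have -> : B = 0 by apply/matrixP=> i j; rewrite !mxE /= mul0r.
rewrite det_lblock; congr (\det _ * _).
  by apply: eq_fmx => s t; rewrite mul1r.
by rewrite -IHm.
Qed.

Lemma det_fmx_block (E T : finType) (F : T -> T -> R) :
  \det (fmx (fun p q : E * T => (p.1 == q.1)%:R * F p.2 q.2)) =
  \det (fmx F) ^+ #|E|.
Proof.
pose h (p : 'I_#|E| * T) : E * T := (enum_val p.1, p.2).
have bij_h : bijective h.
  by exists (fun p => (enum_rank p.1, p.2)) => -[i t];
    rewrite /h /= ?enum_valK ?enum_rankK.
rewrite -(det_fmx_bij _ bij_h) -det_fmx_block_ord; congr (\det _).
by apply: eq_fmx => p q; rewrite (inj_eq enum_val_inj).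
Qed.

End Determinants.

Lemma det_block_schur (R : comUnitRingType) m n (A : 'M[R]_m) (B : 'M_(m, n))
    (C : 'M_(n, m)) (D : 'M_n) : D \in unitmx ->
  \det (block_mx A B C D) = \det D * \det (A - B *m invmx D *m C).
Proof.
move=> uD; have -> : block_mx A B C D = block_mx 1%:M (B *m invmx D) 0 1%:M *m
    block_mx (A - B *m invmx D *m C) 0 C D.
  by rewrite mulmx_block !mul1mx !mul0mx !add0r subrK mulmxKV.
by rewrite det_mulmx det_ublock det_lblock !det1 !mul1r mulrC.
Qed.

(** Schur complement with respect to the second summand, D' being the inverse of
    the corresponding diagonal block. *)
Lemma det_fmx_schur (R : comUnitRingType) (S T : finType)
    (F : S + T -> S + T -> R) (D' : T -> T -> R) :
    (forall t t', \sum_w F (inr t) (inr w) * D' w t' = (t == t')%:R) ->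
  \det (fmx F) =
  \det (fmx (fun t t' => F (inr t) (inr t'))) *
  \det (fmx (fun a b => F (inl a) (inl b) -
    \sum_w (\sum_t F (inl a) (inr t) * D' t w) * F (inr w) (inl b))).
Proof.
move=> DD'; rewrite det_fmx_sum.
set A := fmx (fun a b => F (inl a) (inl b)).
set B := fmx (fun a t => F (inl a) (inr t)).
set C := fmx (fun t a => F (inr t) (inl a)).
set D := fmx (fun t t' => F (inr t) (inr t')).
have DD'1 : D *m fmx D' = 1%:M.
  by rewrite mul_fmx -fmx1; apply: eq_fmx.
have [uD _] := mulmx1_unit DD'1.
have -> : \det (block_mx A B C D) = \det D * \det (A - B *m invmx D *m C).
  exact: det_block_schur.
have -> : invmx D = fmx D' by rewrite -[LHS]mulmx1 -DD'1 mulKmx.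
rewrite !mul_fmx; congr (_ * \det _).
by apply/matrixP=> i j; rewrite !mxE.
Qed.

(** * The resolvent and the coronal *)

Section CharMatrix.
Variable C : fieldType.
Let K : fieldType := {fraction {poly C}}.
Notation cst a := (tofrac a%:P : K).
Notation x := (tofrac 'X : K).

Lemma tofrac_nat (n : nat) : cst n%:R = n%:R.
Proof. by rewrite polyC_natr rmorph_nat. Qed.

Lemma map_char_poly_mx_fmx (T : finType) (M : T -> T -> C) :
  map_mx (@tofrac {poly C}) (char_poly_mx (fmx M)) =
  fmx (fun s t => (s == t)%:R * x - cst (M s t)).
Proof.
apply/matrixP=> i j; rewrite !mxE (inj_eq enum_val_inj).
by rewrite rmorphB /= mulr_natl rmorphMn.
Qed.

Lemma tofrac_char_poly (T : finType) (M : T -> T -> C) :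
  tofrac (char_poly (fmx M)) =
  \det (fmx (fun s t => (s == t)%:R * x - cst (M s t))).
Proof. by rewrite -map_char_poly_mx_fmx det_map_mx. Qed.

Lemma det_charmx_neq0 (T : finType) (M : T -> T -> C) :
  \det (fmx (fun s t => (s == t)%:R * x - cst (M s t))) != 0.
Proof. by rewrite -tofrac_char_poly tofrac_eq0 monic_neq0 // char_poly_monic. Qed.

(** The (s, t) entry of (x I - M)^-1. *)
Definition resolvent (T : finType) (M : T -> T -> C) (s t : T) : K :=
  invmx (fmx (fun s t => (s == t)%:R * x - cst (M s t)))
    (enum_rank s) (enum_rank t).

Lemma mul_resolvent (T : finType) (M : T -> T -> C) (s t : T) :
  \sum_w ((s == w)%:R * x - cst (M s w)) * resolvent M w t = (s == t)%:R.
Proof.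
pose L s t : K := (s == t)%:R * x - cst (M s t); rewrite /resolvent -/L.
have uL : fmx L \in unitmx by rewrite unitmxE unitfE det_charmx_neq0.
have /matrixP/(_ (enum_rank s) (enum_rank t)) := mulmxV uL.
rewrite !mxE (inj_eq enum_rank_inj) => <-.
rewrite -(sum_enum_val (fun w => L s w * _)); apply: eq_bigr => i _.
by rewrite !mxE enum_rankK enum_valK.
Qed.

Lemma coronal_resolvent (T : finType) (M : T -> T -> C) :
  coronal (fmx M) = \sum_s \sum_t resolvent M s t.
Proof.
rewrite /coronal map_char_poly_mx_fmx !mxE exchange_big /=.
rewrite -(sum_enum_val (fun t => \sum_s resolvent M s t)); apply: eq_bigr => j _.
rewrite !mxE mulr1 -(sum_enum_val (fun s => resolvent M s _)).
by apply: eq_bigr => i _; rewrite !mxE mul1r /resolvent !enum_valK.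
Qed.

(** Bordering M by a row and a column of ones, with corner 0, gives a matrix whose
    characteristic polynomial is x - chi times that of M, by Schur complement. *)
Lemma sub_coronal_neq0 (T : finType) (M : T -> T -> C) :
  x - coronal (fmx M) != 0.
Proof.
pose N (p q : unit + T) : C :=
  match p, q with
  | inl _, inl _ => 0
  | inr s, inr t => M s t
  | _, _ => 1
  end.
have := det_charmx_neq0 N.
rewrite (det_fmx_schur (D' := resolvent M)); last first.
  by move=> s t; rewrite -(mul_resolvent M); apply: eq_bigr.
rewrite mulf_eq0 => /norP[_]; apply: contraNneq => xchi0.
apply/eqP; set B := fmx _.
have -> : B = 0 *: 1%:M; last by rewrite detZ expr0n card_unit mul0r.
rewrite scale0r; apply/matrixP=> i j; rewrite !mxE.
case: (enum_val i) (enum_val j) => -[].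
rewrite /= mul1r subr0 -[RHS]xchi0; congr (_ - _).
rewrite coronal_resolvent exchange_big /=.
rewrite !mul0r !sub0r polyC1 tofrac1; apply: eq_bigr => w _.
rewrite mulrN1 -sumrN; apply: eq_bigr => t _.
by rewrite mulN1r opprK.
Qed.

End CharMatrix.

(** * Removing the copies of the second graph *)

Lemma adj_mx_fmx (R : nzRingType) (G : sgraph) :
  adj_mx R G = fmx (fun u v : G => (adj u v)%:R).
Proof. by []. Qed.

Section Corona.
Variable C : fieldType.
Let K : fieldType := {fraction {poly C}}.
Notation cst a := (tofrac a%:P : K).
Notation x := (tofrac 'X : K).
Variables G1 G2 : sgraph.
Let chi : K := coronal (adj_mx C G2).

Lemma charmx_adj (G : sgraph) :
  tofrac (char_poly (adj_mx C G)) =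
  \det (fmx (fun u v : G => (u == v)%:R * x - (adj u v)%:R : K)).
Proof.
rewrite adj_mx_fmx tofrac_char_poly; congr (\det _).
by apply: eq_fmx => u v; rewrite tofrac_nat.
Qed.

Lemma sum_delta_pair (E T : finType) (e : E) (F : E * T -> K) :
  \sum_p (e == p.1)%:R * F p = \sum_t F (e, t).
Proof.
transitivity (\sum_f \sum_t (e == f)%:R * F (f, t)).
  by rewrite pair_bigA; apply: eq_bigr => -[].
rewrite (bigD1 e) //= [X in _ + X]big1 => [|f /negPf ne].
  by rewrite addr0; apply: eq_bigr => t _; rewrite eqxx mul1r.
by rewrite big1 // => t _; rewrite eq_sym ne mul0r.
Qed.

(** The matrix on the right is the characteristic matrix of the central graph,
    with x replaced by x - chi at the subdivision vertices. *)
Lemma char_poly_corona :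
  tofrac (char_poly (adj_mx C (central_edge_corona G1 G2))) =
  tofrac (char_poly (adj_mx C G2)) ^+ #|edge G1| *
  \det (fmx (fun a b : central G1 => (a == b)%:R * x - (adj a b)%:R -
     (if a is inr _ then (a == b)%:R * chi else 0) : K)).
Proof.
rewrite charmx_adj.
pose H := central_edge_corona G1 G2.
pose Rs := resolvent (fun u v : G2 => (adj u v)%:R : C).
pose D' (p q : edge G1 * G2) : K := (p.1 == q.1)%:R * Rs p.2 q.2.
have FD (p q : edge G1 * G2) :
    ((inr p : H) == inr q)%:R * x - (@adj H (inr p) (inr q))%:R =
    (p.1 == q.1)%:R * ((p.2 == q.2)%:R * x - (adj p.2 q.2)%:R) :> K.
  case: p q => [e u] [f v] /=.
  have -> : ((inr (e, u) : H) == inr (f, v)) = (e == f) && (u == v) by [].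
  by case: (e == f); rewrite /= ?mul1r ?mul0r ?subr0.
rewrite (det_fmx_schur (D' := D')); last first.
  move=> [e u] [f v].
  under eq_bigr => w _ do rewrite FD -mulrA.
  rewrite sum_delta_pair /D' /=.
  under eq_bigr => w _ do rewrite mulrCA -(tofrac_nat _ (adj u w)).
  rewrite -mulr_sumr (mul_resolvent (fun u v : G2 => (adj u v)%:R : C)).
  by rewrite -natrM mulnb.
congr (_ * _).
  rewrite charmx_adj -det_fmx_block; congr (\det _).
  by apply: eq_fmx => p q; rewrite FD.
apply: (f_equal determinant); apply: eq_fmx => a b; congr (_ - _).
have Fl (c : central G1) (p : edge G1 * G2) :
    ((inl c : H) == inr p)%:R * x - (@adj H (inl c) (inr p))%:R =
    - (c == inr p.1)%:R :> K.
  by case: p => e u /=; rewrite mul0r sub0r.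
have Fr (c : central G1) (p : edge G1 * G2) :
    ((inr p : H) == inl c)%:R * x - (@adj H (inr p) (inl c))%:R =
    - (c == inr p.1)%:R :> K.
  by case: p => e u /=; rewrite mul0r sub0r.
under eq_bigr => w _ do under eq_bigr => t _ do rewrite Fl.
under eq_bigr => w _ do rewrite Fr mulrN -mulNr -sumrN.
under eq_bigr => w _ do under eq_bigr => t _ do rewrite mulNr opprK.
(* A vertex of the first graph has no neighbour in the copies. *)
case: a => [a|e].
  by rewrite big1 // => w _; rewrite big1 ?mul0r // => t _; rewrite mul0r.
under eq_bigr => w _.
  have -> : \sum_t ((inr e : central G1) == inr t.1)%:R * D' t w =
      (e == w.1)%:R * \sum_u Rs u w.2.
    by rewrite (sum_delta_pair e) mulr_sumr.
  rewrite -mulrA; over.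
rewrite sum_delta_pair /= -mulr_suml mulrC eq_sym; congr (_ * _).
rewrite exchange_big; exact/esym/coronal_resolvent.
Qed.

End Corona.

(** * The incidence matrix and the subdivision vertices *)

Section Incidence.
Variable G : sgraph.

Lemma edge_through (u : G) (e : {set G}) :
  (e \in edges G) && (u \in e) = [exists w, adj u w && (e == [set u; w])].
Proof.
apply/andP/existsP => [[]|[w /andP[uw /eqP->]]]; last first.
  rewrite !inE eqxx; split=> //.
  by apply/existsP; exists u; apply/existsP; exists w; rewrite uw eqxx.
rewrite inE => /existsP[v /existsP[w /andP[vw /eqP->]]].
rewrite !inE => /orP[]/eqP->; first by exists w; rewrite vw eqxx.
by exists v; rewrite adj_sym vw setUC eqxx.
Qed.

Lemma set2_inj (u : G) :
  {in [set w | adj u w] &, injective (fun w => [set u; w])}.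
Proof.
move=> v w; rewrite !inE => uv uw /setP/(_ v); rewrite !inE eqxx orbT.
by case: eqP uv => [->|_ _ /esym/eqP //]; rewrite adj_irr.
Qed.

Lemma card_edges_through r (u v : G) : regular_graph G r ->
  #|[set e in edges G | (u \in e) && (v \in e)]| = ((u == v) * r + adj u v)%N.
Proof.
move=> reg; have [<-|/eqP uv] := eqVneq u v.
  rewrite adj_irr mul1n addn0 -(reg u) -(card_in_imset (@set2_inj u)).
  apply: eq_card => e; rewrite inE andbb edge_through.
  apply/existsP/imsetP => [[w /andP[uw /eqP->]]|[w]].
    by exists w; rewrite ?inE.
  by rewrite inE => uw ->; exists w; rewrite uw eqxx.
rewrite mul0n add0n; have [auv|nauv] := boolP (adj u v); rewrite /=.
  rewrite -(cards1 [set u; v]); apply: eq_card => e.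
  rewrite inE andbA edge_through in_set1.
  apply/andP/eqP => [[/existsP[w /andP[uw /eqP->]]]|->].
    by rewrite !inE => /orP[/eqP/esym//|/eqP->].
  rewrite !inE eqxx orbT; split=> //.
  by apply/existsP; exists v; rewrite auv eqxx.
apply/eqP; rewrite cards_eq0; apply/eqP/setP => e.
rewrite inE andbA edge_through in_set0.
apply/negP => /andP[/existsP[w /andP[uw /eqP->]]].
by rewrite !inE => /orP[/eqP/esym//|/eqP evw]; rewrite evw uw in nauv.
Qed.

(** R R^T = r I + A for the incidence matrix R of an r-regular graph. *)
Lemma incidence_gram (R : pzSemiRingType) r (u v : G) : regular_graph G r ->
  \sum_(e : edge G) (u \in val e)%:R * (v \in val e)%:R =
  (u == v)%:R * r%:R + (adj u v)%:R :> R.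
Proof.
move=> reg; rewrite -natrM -natrD -(card_edges_through _ _ reg).
rewrite -sum1_card natr_sum.
rewrite (eq_bigl (fun e => (e \in edges G) && ((u \in e) && (v \in e))));
  last by move=> e; rewrite inE.
rewrite big_mkcondr [RHS]big_sub; apply: eq_bigr => e _.
by rewrite -natrM mulnb; case: (_ && _).
Qed.

End Incidence.

Section Central.
Variables (K : fieldType) (G : sgraph) (r : nat) (x chi : K).
Hypothesis (reg : regular_graph G r) (y_neq0 : x - chi != 0).

(** Schur complement of the block y I of the subdivision vertices, where
    y = x - chi; the factor y^-1 is then taken out of the remaining matrix. *)
Lemma det_central :
  \det (fmx (fun a b : central G => (a == b)%:R * x - (adj a b)%:R -
     (if a is inr _ then (a == b)%:R * chi else 0) : K)) =
  (x - chi) ^+ #|edge G| * (x - chi)^-1 ^+ #|G| *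
  \det (fmx (fun u v : G => (u == v)%:R * ((x + 1) * (x - chi) - r%:R)
      - (x - chi) + (adj u v)%:R * (x - chi - 1) : K)).
Proof.
set y := x - chi.
pose D' (e f : edge G) : K := (e == f)%:R * y^-1.
have FD (e f : edge G) :
    ((inr e : central G) == inr f)%:R * x
    - (@adj (central G) (inr e) (inr f))%:R
    - ((inr e : central G) == inr f)%:R * chi = (e == f)%:R * y :> K.
  by rewrite /= subr0 mulrBr.
rewrite (det_fmx_schur (D' := D')); last first.
  move=> e f; under eq_bigr => w _ do rewrite FD -mulrA.
  rewrite (bigD1 e) //= big1 => [|w /negPf ne].
    by rewrite addr0 eqxx mul1r /D' mulrCA mulfV // mulr1.
  by rewrite eq_sym ne mul0r.
rewrite -mulrA; congr (_ * _).
  rewrite -det_scalar; congr (\det _); apply/matrixP => i j; rewrite !mxE.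
  by rewrite FD (inj_eq enum_val_inj) mulr_natl.
rewrite -detZ; congr (\det _).
apply/matrixP => i j; rewrite !mxE.
move: (enum_val i) (enum_val j) => u v.
rewrite (eq_bigr (fun e : edge G =>
    y^-1 * ((u \in val e)%:R * (v \in val e)%:R))) => [|e _]; last first.
  rewrite /= !mul0r !subr0 !sub0r (bigD1 e) //= big1 => [|w /negPf ne].
    by rewrite addr0 /D' eqxx mul1r; ring.
  by rewrite /D' ne mul0r mulr0.
rewrite -mulr_sumr (incidence_gram _ _ _ reg).
have -> : ((u != v) && ~~ adj u v)%:R = 1 - (u == v)%:R - (adj u v)%:R :> K.
  have [<-|_] := eqVneq; first by rewrite adj_irr subr0 subrr.
  by case: adj; rewrite /= ?subr0 ?subrr.
by field.
Qed.

End Central.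

(** * Spectra *)

Section Spectrum.
Variable C : numClosedFieldType.

Lemma char_poly_spectrum n (M : 'M[C]_n) :
  char_poly M = \prod_(z <- spectrum M) ('X - z%:P).
Proof.
rewrite /spectrum; case: closed_field_poly_normal => s /= def_p.
rewrite (perm_big s) ?perm_sort //.
by rewrite {1}def_p (monicP (char_poly_monic M)) scale1r.
Qed.

Lemma size_spectrum n (M : 'M[C]_n) : size (spectrum M) = n.
Proof.
by have := size_char_poly M; rewrite char_poly_spectrum size_prod_XsubC => -[].
Qed.

Lemma spectrum_similar n (U M : 'M[C]_n) (d : 'rV_n) : U \in unitmx ->
  U *m M = diag_mx d *m U -> perm_eq (spectrum M) [seq d 0 i | i : 'I_n].
Proof.
move=> uU sim; apply: prod_XsubC_eq; rewrite -char_poly_spectrum big_image /=.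
have uV : map_mx polyC U \in unitmx.
  by rewrite unitmxE det_map_mx rmorph_unit // -unitmxE.
have simX : map_mx polyC U *m char_poly_mx M =
    char_poly_mx (diag_mx d) *m map_mx polyC U.
  by rewrite /char_poly_mx mulmxBr mulmxBl -!map_mxM sim scalar_mxC.
apply: (@mulIr _ (\det (map_mx polyC U))); first by rewrite -unitmxE.
rewrite mulrC /char_poly -det_mulmx simX det_mulmx; congr (_ * _).
rewrite -/(char_poly _) char_poly_trig ?diag_mx_is_trig //.
by apply: eq_bigr => i _; rewrite mxE eqxx.
Qed.

Lemma prod_eigenval (R : comPzRingType) (G : sgraph) (F : C -> R) :
  \prod_(i < #|G|) F (eigenval C i) = \prod_(z <- spectrum (adj_mx C G)) F z.
Proof. by rewrite (big_nth 0) size_spectrum big_mkord. Qed.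

Lemma adj_mx_normal (G : sgraph) : adj_mx C G \is normalmx.
Proof.
apply/normalmxP; suff -> : map_mx Num.conj (adj_mx C G)^T = adj_mx C G by [].
by apply/matrixP=> i j; rewrite !mxE conjC_nat adj_sym.
Qed.

Section AssocPoly.
Variables (G : sgraph) (r : nat).
Local Notation A := (adj_mx C G).
Local Notation P := (assoc_poly C G r).

Lemma assoc_poly_degree : P.[r%:R] = #|G|%:R.
Proof.
rewrite /assoc_poly hornerZ horner_prod big1 ?mulr1 // => t tr.
by rewrite hornerZ hornerXsubC mulVf // subr_eq0 eq_sym.
Qed.

Lemma assoc_poly_eigen (z : C) : z \in spectrum A -> z != r%:R -> P.[z] = 0.
Proof.
move=> zA zr; rewrite /assoc_poly hornerZ horner_prod.
rewrite (big_rem z) ?mem_undup //= zr hornerZ hornerXsubC subrr mulr0 mul0r.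
by rewrite mulr0.
Qed.

End AssocPoly.

(** * The all-ones matrix as a polynomial in the adjacency matrix *)

Section Kernel.
Variables (G : sgraph) (r : nat).
Hypotheses (G_connected : connected_graph G) (G_regular : regular_graph G r).

Lemma sum_adj (u : G) : \sum_v (adj u v)%:R = r%:R :> C.
Proof.
rewrite -(G_regular u) -sum1_card natr_sum [RHS]big_mkcond.
by apply: eq_bigr => v _; rewrite inE; case: adj.
Qed.

(** If A v = r v, then the sum of |v u - v w|^2 over all ordered pairs of adjacent
    vertices vanishes, so v is constant along edges. *)
Lemma degree_eigenvector_const (v : G -> C) :
  (forall u, \sum_w (adj u w)%:R * v w = r%:R * v u) -> forall u w, v u = v w.
Proof.
move=> Av.
have form0 : \sum_u \sum_w (adj u w)%:R * `|v u - v w| ^+ 2 = 0.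
  (* |v u - v w|^2 is the sum of (v u - v w) (v u)^* and of the same term with u
     and w exchanged. *)
  pose half := \sum_u \sum_w (adj u w)%:R * ((v u - v w) * (v u)^*).
  have half0 : half = 0.
    rewrite /half big1 // => u _.
    under eq_bigr => w _ do rewrite mulrA mulrBr.
    by rewrite -mulr_suml sumrB -mulr_suml sum_adj Av subrr mul0r.
  transitivity (half + half); last by rewrite half0 addr0.
  rewrite {2}/half [X in _ = _ + X]exchange_big -big_split.
  apply: eq_bigr => u _ /=.
  rewrite -big_split; apply: eq_bigr => w _ /=.
  by rewrite normCK rmorphB (adj_sym w u) /=; ring.
have edge_eq u w : adj u w -> v u = v w.
  move=> uw; apply/eqP; rewrite -subr_eq0 -normr_eq0 -sqrf_eq0.
  have term_ge0 a b : 0 <= (adj a b)%:R * `|v a - v b| ^+ 2.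
    by rewrite mulr_ge0 ?ler0n ?exprn_ge0.
  move/eqP: form0; rewrite psumr_eq0 => [|a _]; last by rewrite sumr_ge0.
  move=> /allP/(_ u); rewrite mem_index_enum => /(_ isT)/=.
  rewrite psumr_eq0 // => /allP/(_ w); rewrite mem_index_enum => /(_ isT)/=.
  by rewrite uw mul1r.
move=> u w; have [_ /(_ u w) /connectP[p]] := G_connected.
elim: p u => [u _ -> //|a p IHp u /= /andP[ua pa] wl].
by rewrite (edge_eq _ _ ua); apply: IHp.
Qed.

Lemma tr_adj_mx : (adj_mx C G)^T = adj_mx C G.
Proof. by apply/matrixP=> i j; rewrite !mxE adj_sym. Qed.

Lemma degree_eigenmx_const m (M : 'M[C]_(#|G|, m)) :
  adj_mx C G *m M = r%:R *: M -> forall i i' j, M i j = M i' j.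
Proof.
move=> AM i i' j; rewrite -(enum_valK i) -(enum_valK i').
apply: (degree_eigenvector_const (v := fun u => M (enum_rank u) j)) => u.
have /matrixP/(_ (enum_rank u) j) := AM; rewrite !mxE => <-.
rewrite -(sum_enum_val (fun w => _ * M (enum_rank w) j)).
by apply: eq_bigr => k _; rewrite !mxE enum_rankK enum_valK.
Qed.

(** A simultaneous diagonalization of A and of the all-ones matrix, which shows
    that the latter is P(A). *)
Lemma adj_mx_diag : exists U : 'M[C]_#|G|, exists d : 'rV[C]_#|G|,
  [/\ U \in unitmx,
      adj_mx C G = invmx U *m diag_mx d *m U,
      perm_eq (spectrum (adj_mx C G)) [seq d 0 i | i : 'I_#|G|] &
      const_mx 1 =
        invmx U *m diag_mx (map_mx (horner (assoc_poly C G r)) d) *m U].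
Proof.
set A := adj_mx C G; set P := assoc_poly C G r.
set U := spectralmx A; set d := spectral_diag A.
have uU : U \in unitmx := spectral_unit A.
have defA : A = invmx U *m diag_mx d *m U.
  by apply/orthomx_spectralP; apply: adj_mx_normal.
have UA : U *m A = diag_mx d *m U.
  by rewrite {1}defA !mulmxA mulmxV // mul1mx.
have sp_d := spectrum_similar uU UA.
exists U, d; split=> //.
set D := diag_mx _; set Q := _ *m D *m U.
have Pd i : d 0 i * P.[d 0 i] = r%:R * P.[d 0 i].
  have [->//|nr] := eqVneq (d 0 i) r%:R.
  by rewrite assoc_poly_eigen ?mulr0 // (perm_mem sp_d); exact: image_f.
have dD : diag_mx d *m D = r%:R *: D.
  rewrite /D mulmx_diag -linearZ; congr diag_mx.
  by apply/rowP => i; rewrite !mxE Pd.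
have QA : Q *m A = r%:R *: Q.
  rewrite {1}defA /Q !mulmxA mulmxK // -(mulmxA (invmx U)) diag_mxC dD.
  by rewrite -scalemxAr -scalemxAl.
have rowQ i j j' : Q i j = Q i j'.
  have AQt : A *m Q^T = r%:R *: Q^T by rewrite -[A]tr_adj_mx -trmx_mul QA linearZ.
  by have := degree_eigenmx_const AQt j j' i; rewrite !mxE.
(* The row sums of Q, with e the all-ones column: U e is supported on the indices
   i with d i = r, where P takes the value #|G|. *)
pose e : 'cV[C]_#|G| := const_mx 1.
have Ae : A *m e = r%:R *: e.
  apply/matrixP => i j; rewrite !mxE mulr1 -(sum_adj (enum_val i)).
  rewrite -(sum_enum_val (fun w => (adj _ w)%:R)).
  by apply: eq_bigr => k _; rewrite !mxE mulr1.
have Qe : Q *m e = #|G|%:R *: e.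
  rewrite /Q -!mulmxA -[RHS](mulKmx uU) -scalemxAr; congr (_ *m _).
  have dUe : diag_mx d *m (U *m e) = r%:R *: (U *m e).
    by rewrite mulmxA -UA -mulmxA Ae -scalemxAr.
  apply/colP => i; have /colP/(_ i) := dUe.
  rewrite !mul_diag_mx !mxE => /eqP; rewrite -subr_eq0 -mulrBl mulf_eq0.
  case/orP => [|/eqP->]; last by rewrite !mulr0.
  by rewrite subr_eq0 => /eqP->; rewrite assoc_poly_degree.
have n_neq0 : #|G|%:R != 0 :> C by rewrite pnatr_eq0 -lt0n; case: G_connected.
clearbody Q; apply/matrixP => i j; rewrite mxE.
apply: (mulfI n_neq0); rewrite mulr1.
have /colP/(_ i) := Qe; rewrite !mxE mulr1 => sumQ; rewrite -[LHS]sumQ.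
rewrite (eq_bigr (fun=> Q i j)) => [|k _]; last by rewrite mxE mulr1; apply: rowQ.
by rewrite sumr_const card_ord mulr_natl.
Qed.

End Kernel.

(** det (a I - b J + c A), for scalars in an extension K of C, as a product over
    the spectrum of A. *)
Lemma det_adj_polynomial (K : fieldType) (f : {rmorphism C -> K})
    (G : sgraph) (r : nat) (a b c : K) :
    connected_graph G -> regular_graph G r ->
  \det (fmx (fun u v : G => (u == v)%:R * a - b + (adj u v)%:R * c)) =
  \prod_(i < #|G|) (a - f (assoc_poly C G r).[eigenval C i] * b
                    + c * f (eigenval C i)).
Proof.
move=> G_conn G_reg; have [U [d [uU defA sp_d defJ]]] := adj_mx_diag G_conn G_reg.
pose F z : K := a - f (assoc_poly C G r).[z] * b + c * f z.
rewrite (prod_eigenval G F) (perm_big _ sp_d) big_image /=.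
have uU' : map_mx f U \in unitmx by rewrite map_unitmx.
have -> : fmx (fun u v : G => (u == v)%:R * a - b + (adj u v)%:R * c) =
    a%:M - b *: map_mx f (const_mx 1) + c *: map_mx f (adj_mx C G).
  apply/matrixP => i j; rewrite !mxE (inj_eq enum_val_inj) !rmorph1 mulr1.
  by rewrite mulr_natl rmorph_nat mulrC.
have -> : a%:M - b *: map_mx f (const_mx 1) + c *: map_mx f (adj_mx C G) =
    invmx (map_mx f U) *m diag_mx (\row_i F (d 0 i)) *m map_mx f U.
  rewrite defJ [in LHS]defA !map_mxM map_invmx !map_diag_mx.
  set V := map_mx f U.
  have -> : a%:M = invmx V *m a%:M *m V by rewrite scalar_mxC mulmxKV.
  have scaleV k E : k *: (invmx V *m E *m V) = invmx V *m (k *: E) *m V.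
    by rewrite -scalemxAr -scalemxAl.
  rewrite !scaleV -mulmxBl -mulmxBr -mulmxDl -mulmxDr.
  congr (_ *m _ *m _); apply/matrixP => i j; rewrite !mxE /F.
  by case: (i == j); rewrite ?mulr0n ?mulr1n ?mulr0 ?subr0 ?addr0 // (mulrC b).
rewrite !det_mulmx det_inv mulrC mulrA divff ?mul1r;
  last by rewrite -unitfE -unitmxE.
by rewrite det_diag; apply: eq_bigr => i _; rewrite mxE.
Qed.

End Spectrum.

Theorem theorem4p1 (C : numClosedFieldType) (G1 G2 : sgraph) (r1 : nat)
    (G1_connected : connected_graph G1) (G2_connected : connected_graph G2)
    (G1_regular : regular_graph G1 r1) :
  let n1 := #|G1| in
  let m1 := #|edges G1| in
  let n2 := #|G2| in
  let K := {fraction {poly C}} in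
  let cst (a : C) : K := tofrac a%:P in
  let x : K := tofrac 'X in
  let chi : K := coronal (adj_mx C G2) in
  let lambda1 (i : 'I_n1) : C := eigenval C i in
  let lambda2 (j : 'I_n2) : C := eigenval C j in
  let P : {poly C} := assoc_poly C G1 r1 in
  tofrac (char_poly (adj_mx C (central_edge_corona G1 G2))) =
    (x - chi) ^ (m1%:Z - n1%:Z)
    * \prod_(j < n2) (x - cst (lambda2 j)) ^+ m1
    * \prod_(i < n1)
        ((x + 1) * (x - chi) - r1%:R
         - cst P.[lambda1 i] * (x - chi)
         + (x - chi - 1) * cst (lambda1 i)).
Proof.
move=> n1 m1 n2 K cst x chi lambda1 lambda2 P.
have y_neq0 : x - chi != 0.
  exact: (sub_coronal_neq0 (fun u v : G2 => (adj u v)%:R)).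
pose f : {rmorphism C -> K} := @tofrac {poly C} \o polyC.
have m1E : #|edge G1| = m1 by rewrite card_sig.
rewrite char_poly_corona (det_central G1_regular y_neq0) m1E.
rewrite (det_adj_polynomial f _ _ _ G1_connected G1_regular) mulrA.
congr (_ * _); rewrite mulrC; congr (_ * _).
  by rewrite expfzDr // -invr_expz exprVn.
rewrite (prod_eigenval G2 (fun z => (x - cst z) ^+ m1)) prodrXl.
congr (_ ^+ _); rewrite char_poly_spectrum rmorph_prod.
by apply: eq_bigr => z _; rewrite rmorphB.
Qed.
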